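(* Assuming Markov's principle, the following are equivalent: (1) the limited principle of omniscience $\mathsf{LPO}$; (2) $\mathbb{N} + \mathbb{N}_\infty$ has the $\neg\neg$ strong Myhill property.
   Context: The statement is to be proved constructively (intuitionistic set theory with powersets and $\mathbb{N}$, equivalently the internal logic of a topos with natural numbers object; neither excluded middle nor choice is assumed). $\mathbb{N}_\infty \subseteq 2^{\mathbb{N}}$ is the set of bit sequences containing at most one $1$; $+$ is disjoint union. Markov's principle: for every $p \in 2^{\mathbb{N}}$, if $p \neq 0^\omega$ (the constant $0$ sequence), then there exists $n$ with $p_n = 1$. $\mathsf{LPO}$: for every $p \in 2^{\mathbb{N}}$, either $p = 0^\omega$ or there exists $n$ with $p_n = 1$. For injections $f, g : X \to X$ and $m \in \mathbb{Z}$, let $R^{f,g}_m \subseteq X \times X$ be the partial injection $f \circ (g \circ f)^m$: for $m \ge 0$, $(x,y) \in R^{f,g}_m$ iff $y = f((g\circ f)^m(x))$; for $m < 0$, $(x,y) \in R^{f,g}_m$ iff $x = g((f \circ g)^{-m-1}(y))$. A set $X$ has the $\neg\neg$ strong Myhill property if for every pair of injections $f, g : X \to X$ there is a bijection $h : X \to X$ such that for every $x \in X$, $\neg\neg\, \exists m \in \mathbb{Z}.\ (x,h(x)) \in R^{f,g}_m$. *)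

(* Defs.v *)
From mathcomp Require Import all_boot ssrint.
Set Implicit Arguments.
Unset Strict Implicit.
Unset Printing Implicit Defensive.

(* The ambient constructive theory is Rocq's own logic, with the logical       *)
(* connectives in Prop; no classical or choice axiom is imported.  The         *)
(* functions of a topos are extensional and coincide with the functional total *)
(* relations; for Rocq functions this amounts to functional_extensionality_dep *)
(* and constructive_definite_description, both valid in every topos.           *)

Definition zero_seq : nat -> bool := fun=> false.

Definition Markov_principle : Prop :=
  forall p : nat -> bool, p <> zero_seq -> exists n, p n = true.

Definition LPO : Prop :=
  forall p : nat -> bool, p = zero_seq \/ exists n, p n = true.

Definition at_most_one_1 (p : nat -> bool) : Prop :=
  forall m n, p m = true -> p n = true -> m = n.

Definition Ninfty : Type := {p : nat -> bool | at_most_one_1 p}.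

(* The integer Negz n is - (n + 1), so that n = - m - 1 when m = Negz n. *)
Definition Rrel (X : Type) (f g : X -> X) (m : int) (x y : X) : Prop :=
  match m with
  | Posz n => y = f (iter n (g \o f) x)
  | Negz n => x = g (iter n (f \o g) y)
  end.

Definition nn_strong_Myhill (X : Type) : Prop :=
  forall f g : X -> X, injective f -> injective g ->
  exists h : X -> X, bijective h /\
    forall x : X, ~ ~ exists m : int, Rrel f g m x (h x).

(* Main.v *)
(* From LPO to Myhill: LPO makes equality on nat + Ninfty and existential       *)
(* quantification over it decidable, so that the classical Cantor-Bernstein    *)
(* case distinction can be carried out.                                        *)
(*                                                                             *)
(* From Myhill to LPO: let f send nat to the even and Ninfty to the odd        *)
(* elements of Ninfty, and let g send n to 2n + 1 in nat and fix Ninfty.  An   *)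
(* even n in the first summand starts a chain which then stays among the       *)
(* finite elements of Ninfty, so h n is such an element, while h sends no      *)
(* element of nat to infinity.  Hence the test whether h^-1 u is in the first  *)
(* summand holds for infinitely many finite u but fails at infinity.  Given p, *)
(* let u be the first finite element passing the test that comes after a 1 of  *)
(* p, or infinity if there is none: testing u decides whether p has a 1.       *)

From mathcomp Require Import all_boot ssrint.
From Stdlib Require Import FunctionalExtensionality Description.
Require Import Defs.
Set Implicit Arguments.
Unset Strict Implicit.
Unset Printing Implicit Defensive.

(** Under [LPO] one can decide on which side a chain of [f] and [g] begins, so [h] can be the
    Cantor-Bernstein bijection, each value of which is [f x] or a [g]-preimage of [x]
    ([strong_Myhill_dec]). Conversely, for [to_Ninfty] and [odd_left], any [h] that follows the
    chains up to double negation sends even numbers into [Ninfty] and no number to infinity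
    ([Rrel_even], [Rrel_inf]). Which summand a point lies in is decidable, so the double negation
    does no harm, and Markov's principle makes the images of the even numbers finite. The inverse of
    [h] thus gives a Boolean test on [Ninfty] that is discontinuous at infinity, and such a test
    yields [LPO] ([LPO_of_unbounded_test]). *)

Definition decidable_prop (A : Prop) : Prop := A \/ ~ A.

Definition searchable (X : Type) : Prop :=
  forall P : X -> Prop, (forall x, decidable_prop (P x)) ->
  decidable_prop (exists x, P x).

(** [LPO] speaks of Boolean sequences only; unique description turns the decidable [P] into one. *)
Lemma LPO_searchable_nat : LPO -> searchable nat.
Proof.
move=> lpo P decP.
have uniq_b n : exists! b : bool, b = true <-> P n.
  case: (decP n) => Pn; [exists true | exists false]; (split; first by split).
    by move=> b [_ /(_ Pn)].
  by case=> // -[/(_ erefl)].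
pose p n := proj1_sig (constructive_definite_description _ (uniq_b n)).
have pP n : p n = true <-> P n.
  exact: proj2_sig (constructive_definite_description _ (uniq_b n)).
case: (lpo p) => [p0 | [n pn]]; last by left; exists n; apply/pP.
by right=> -[n /pP]; rewrite p0.
Qed.

Lemma bijective_of_graph (X Y : Type) (H : X -> Y -> Prop) :
  (forall x, exists! y, H x y) -> (forall y, exists! x, H x y) ->
  exists h : X -> Y, bijective h /\ forall x, H x (h x).
Proof.
move=> totH surH.
pose h x := proj1_sig (constructive_definite_description _ (totH x)).
have hP x : H x (h x) := proj2_sig (constructive_definite_description _ (totH x)).
pose k y := proj1_sig (constructive_definite_description _ (surH y)).
have kP y : H (k y) y := proj2_sig (constructive_definite_description _ (surH y)).
exists h; split=> //; exists k => [x | y].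
  by have [z [_ uz]] := surH (h x); rewrite -(uz _ (kP _)); apply: uz.
by have [z [_ uz]] := totH (k y); rewrite -(uz _ (hP _)); apply: uz.
Qed.

(** * Cantor-Bernstein under decidability *)

Section CantorBernstein.

Variables (X : Type) (f g : X -> X).
Hypotheses (injf : injective f) (injg : injective g).

(** Traced back from [x] by inverses of [g] and [f] in turn, the chain stops at a [y] of the
    codomain outside the image of [f]. On such [x] the bijection is the inverse of [g], elsewhere it
    is [f]. *)
Definition starts_right (x : X) : Prop :=
  exists n y, x = iter n (g \o f) (g y) /\ ~ exists z, f z = y.

Lemma starts_right_gf x : starts_right (g (f x)) <-> starts_right x.
Proof.
split=> [[[|n] [y [/= Ex nfy]]] | [n [y [-> nfy]]]]; last by exists n.+1, y.
  by case: nfy; exists x; apply: injg.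
by exists n, y; split=> //; apply/injf/injg.
Qed.

Lemma starts_right_im x : starts_right x -> exists y, g y = x.
Proof. by case=> -[|n] [y [-> _]]; eexists. Qed.

Lemma strong_Myhill_dec :
  (forall x, decidable_prop (starts_right x)) ->
  (forall y, decidable_prop (exists x, f x = y)) ->
  exists h : X -> X, bijective h /\ forall x, exists m, Rrel f g m x (h x).
Proof.
move=> decS decf.
pose H x y := (starts_right x /\ g y = x) \/ (~ starts_right x /\ y = f x).
have [x | y | h [bijh hP]] := @bijective_of_graph _ _ H.
- case: (decS x) => Sx.
    have [y Ey] := starts_right_im Sx; exists y; split; first by left.
    by move=> y' [[_ Ey'] | []] //; apply: injg; rewrite Ey.
  by exists (f x); split=> [|y [[] | []]] //; right.
- case: (decS (g y)) => Sy.
    exists (g y); split=> [|x [[] | [nSx Ey]]] //; first by left.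
    by case: nSx; apply/starts_right_gf; rewrite -Ey.
  (* A [y] outside the image of [f] would itself be the start of the chain of [g y]. *)
  case: (decf y) => [[x Ex] | nfy]; last by case: Sy; exists 0, y.
  subst y; exists x; split=> [|x' [[Sx' Ex'] | [_ /injf]]] //.
    by right; split=> // /starts_right_gf.
  by case: Sy; rewrite Ex'.
exists h; split=> // x.
by case: (hP x) => -[_ Ex]; [exists (Negz 0) | exists (Posz 0)].
Qed.

End CantorBernstein.

Lemma searchable_strong_Myhill (X : Type) (f g : X -> X) :
  searchable nat -> searchable X ->
  (forall x y : X, decidable_prop (x = y)) ->
  injective f -> injective g ->
  exists h : X -> X, bijective h /\ forall x, exists m, Rrel f g m x (h x).
Proof.
move=> sN sX eqX injf injg.
have decf y : decidable_prop (exists x, f x = y) by apply: sX => x; apply: eqX.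
apply: strong_Myhill_dec => // x; apply: sN => n; apply: sX => y.
case: (eqX x (iter n (g \o f) (g y))) => [-> | nE]; last by right=> -[].
by case: (decf y) => fy; [right=> -[] | left].
Qed.

(** * Points of [Ninfty], and the direction from [LPO] *)

Lemma Ninfty_ext (u v : Ninfty) : sval u =1 sval v -> u = v.
Proof.
case: u v => [p p1] [q q1] /= /functional_extensionality Epq.
subst q; congr exist.
(* A proof of [at_most_one_1] is a function of four arguments into equalities of naturals, whose
   proofs are unique. *)
by do 4![apply: functional_extensionality_dep => ?]; apply: eq_irrelevance.
Qed.

Lemma Ninfty_fin_subproof n : at_most_one_1 (pred1 n).
Proof. by move=> i j /eqP-> /eqP->. Qed.
Definition Ninfty_fin n : Ninfty := exist _ _ (@Ninfty_fin_subproof n).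

Lemma Ninfty_inf_subproof : at_most_one_1 zero_seq.
Proof. by []. Qed.
Definition Ninfty_inf : Ninfty := exist _ _ (@Ninfty_inf_subproof).

Lemma Ninfty_finE (u : Ninfty) n : sval u n = true -> u = Ninfty_fin n.
Proof.
case: u => p p1 /= pn; apply: Ninfty_ext => k /=.
by apply/idP/eqP => [pk | -> //]; apply: p1.
Qed.

Lemma Ninfty_infE (u : Ninfty) : sval u = zero_seq -> u = Ninfty_inf.
Proof. by move=> Eu; apply: Ninfty_ext; rewrite Eu. Qed.

Lemma Markov_Ninfty (u : Ninfty) :
  Markov_principle -> u <> Ninfty_inf -> exists n, u = Ninfty_fin n.
Proof.
move=> mp nu; have [|n /Ninfty_finE] := mp (sval u); last by exists n.
by move/Ninfty_infE.
Qed.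

Lemma LPO_Ninfty (u : Ninfty) :
  LPO -> u = Ninfty_inf \/ exists n, u = Ninfty_fin n.
Proof.
move=> lpo; case: (lpo (sval u)) => [/Ninfty_infE | [n /Ninfty_finE]]; first by left.
by right; exists n.
Qed.

Lemma LPO_eq_Ninfty (u v : Ninfty) : LPO -> decidable_prop (u = v).
Proof.
move=> lpo; case: (lpo (fun n => sval u n != sval v n)) => [E | [n]].
  by left; apply: Ninfty_ext => n; have /negbFE/eqP := congr1 (@^~ n) E.
by move=> /eqP nE; right=> E; rewrite E in nE.
Qed.

Lemma LPO_searchable_Ninfty : LPO -> searchable Ninfty.
Proof.
move=> lpo P decP; case: (decP Ninfty_inf) => Pinf; first by left; exists Ninfty_inf.
case: (LPO_searchable_nat lpo (fun n => decP (Ninfty_fin n))) => [[n Pn] | nP].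
  by left; exists (Ninfty_fin n).
right=> -[u Pu]; case: (LPO_Ninfty u lpo) => [Eu | [n Eu]].
  by rewrite Eu in Pu.
by case: nP; exists n; rewrite -Eu.
Qed.

Lemma searchable_sum (X Y : Type) :
  searchable X -> searchable Y -> searchable (X + Y).
Proof.
move=> sX sY P decP.
case: (sX _ (fun x => decP (inl x))) => [[x Px] | nX]; first by left; exists (inl x).
case: (sY _ (fun y => decP (inr y))) => [[y Py] | nY]; first by left; exists (inr y).
by right=> -[[x Px | y Py]]; [apply: nX; exists x | apply: nY; exists y].
Qed.

Lemma LPO_Myhill : LPO -> nn_strong_Myhill (nat + Ninfty).
Proof.
move=> lpo f g injf injg.
have sN := LPO_searchable_nat lpo.
have sX := searchable_sum sN (LPO_searchable_Ninfty lpo).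
have [|h [bijh hP]] := searchable_strong_Myhill sN sX _ injf injg; last first.
  by exists h; split=> // x nR; apply: nR.
move=> [m|u] [n|v]; try by right.
  by case: (eqVneq m n) => [-> | /eqP mn]; [left | right=> -[]].
by case: (LPO_eq_Ninfty u v lpo) => [-> | nuv]; [left | right=> -[]].
Qed.

(** * Discontinuous tests on [Ninfty] *)

(* The element equal to the least [k] with [q k], or to infinity.               *)
Lemma Ninfty_first_subproof (q : nat -> bool) :
  at_most_one_1 (fun k => q k && ~~ has q (iota 0 k)).
Proof.
move=> i j /andP[qi /hasPn ni] /andP[qj /hasPn nj].
case: (ltngtP i j) => // [ij | ji].
  by have := nj i; rewrite mem_iota qi => /(_ ij).
by have := ni j; rewrite mem_iota qj => /(_ ji).
Qed.
Definition Ninfty_first (q : nat -> bool) : Ninfty :=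
  exist _ _ (@Ninfty_first_subproof q).

Lemma Ninfty_first_fin (q : nat -> bool) k :
  q k -> exists2 m, q m & Ninfty_first q = Ninfty_fin m.
Proof.
move=> qk; have exq : exists k, q k by exists k.
case: (ex_minnP exq) => m qm minm; exists m => //; apply: Ninfty_finE => /=.
rewrite qm /=; apply/hasPn => i; rewrite mem_iota /= add0n => lt_im.
by apply/negP => /minm; rewrite leqNgt lt_im.
Qed.

(** Unboundedness can stay negative: it only serves to refute a 1 of [p] when the test on
    [Ninfty_first q] fails. *)
Lemma LPO_of_unbounded_test (phi : Ninfty -> bool) :
  Markov_principle -> phi Ninfty_inf = false ->
  (forall n, ~ forall k, phi (Ninfty_fin k) -> k < n) -> LPO.
Proof.
move=> mp phi_inf unb p.
pose q k := phi (Ninfty_fin k) && has p (iota 0 k.+1).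
case phi_u: (phi (Ninfty_first q)); last first.
  left; apply: functional_extensionality => n; apply/negP => pn.
  (* With [p n = true], any [k >= n] passing the test satisfies [q], so [Ninfty_first q] would be
     finite and pass. *)
  apply: (unb n) => k phi_k; rewrite ltnNge; apply/negP => le_nk.
  have [|m /andP[phi_m _] Em] := @Ninfty_first_fin q k.
    by rewrite /q phi_k; apply/hasP; exists n => //; rewrite mem_iota.
  by rewrite Em phi_m in phi_u.
right; have [Eu | k Ek] := @Markov_Ninfty (Ninfty_first q) mp.
  by rewrite Eu phi_inf in phi_u.
have : sval (Ninfty_first q) k by rewrite Ek /=.
by case/andP=> /andP[_ /hasP[n _ pn]] _; exists n.
Qed.

(** * The pair of injections that forces [LPO] *)

Lemma Ninfty_odd_subproof (u : Ninfty) :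
  at_most_one_1 (fun k => odd k && sval u k./2).
Proof.
move=> i j /andP[oi ui] /andP[oj uj].
by rewrite -(odd_double_half i) -(odd_double_half j) oi oj (proj2_sig u _ _ ui uj).
Qed.
(* The map [u |-> 2 u + 1].                                                     *)
Definition Ninfty_odd (u : Ninfty) : Ninfty := exist _ _ (@Ninfty_odd_subproof u).

Lemma Ninfty_oddE (u : Ninfty) k : sval (Ninfty_odd u) k.*2.+1 = sval u k.
Proof. by rewrite /= odd_double uphalf_double. Qed.

Lemma Ninfty_odd_inj : injective Ninfty_odd.
Proof. by move=> u v E; apply: Ninfty_ext => k; rewrite -[LHS]Ninfty_oddE E Ninfty_oddE. Qed.

Lemma Ninfty_odd_inf : Ninfty_odd Ninfty_inf = Ninfty_inf.
Proof. by apply: Ninfty_ext => k /=; rewrite andbF. Qed.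

Lemma Ninfty_fin_inf n : Ninfty_fin n <> Ninfty_inf.
Proof. by move/(congr1 (fun u => sval u n)); rewrite /= eqxx. Qed.

Lemma Ninfty_fin_inj : injective Ninfty_fin.
Proof. by move=> m n /(congr1 (fun u => sval u m)); rewrite /= eqxx => /esym/eqP. Qed.

Lemma Ninfty_fin_odd n u : Ninfty_fin n.*2 <> Ninfty_odd u.
Proof. by move/(congr1 (fun u => sval u n.*2)); rewrite /= eqxx odd_double. Qed.

Definition to_Ninfty (x : nat + Ninfty) : nat + Ninfty :=
  match x with
  | inl n => inr (Ninfty_fin n.*2)
  | inr u => inr (Ninfty_odd u)
  end.

Definition odd_left (x : nat + Ninfty) : nat + Ninfty :=
  match x with
  | inl n => inl n.*2.+1
  | inr u => inr u
  end.

Lemma to_Ninfty_inj : injective to_Ninfty.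
Proof.
move=> [m|u] [n|v] /= H; move: (inr_inj H).
- by move/Ninfty_fin_inj/double_inj->.
- by move/Ninfty_fin_odd.
- by move/esym/Ninfty_fin_odd.
- by move/Ninfty_odd_inj->.
Qed.

Lemma odd_left_inj : injective odd_left.
Proof. by move=> [m|u] [n|v] //= [] /double_inj->. Qed.

Lemma to_Ninfty_inf x : to_Ninfty x = inr Ninfty_inf <-> x = inr Ninfty_inf.
Proof.
split=> [|-> /=]; last by rewrite Ninfty_odd_inf.
case: x => [n|u] /= H; have Eu := inr_inj H; first by case: (Ninfty_fin_inf Eu).
by congr inr; apply: Ninfty_odd_inj; rewrite Ninfty_odd_inf.
Qed.

Lemma odd_left_inf x : odd_left x = inr Ninfty_inf <-> x = inr Ninfty_inf.
Proof. by case: x. Qed.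

(** Infinity is its own only preimage under both maps, so its chain never meets [nat]. *)
Lemma Rrel_inf m n : ~ Rrel to_Ninfty odd_left m (inl n) (inr Ninfty_inf).
Proof.
case: m => m /=.
  move/esym/to_Ninfty_inf; elim: m => //= m IHm.
  by move=> /odd_left_inf/to_Ninfty_inf.
have -> : iter m (to_Ninfty \o odd_left) (inr Ninfty_inf) = inr Ninfty_inf.
  by elim: m => //= m ->; rewrite /= Ninfty_odd_inf.
by [].
Qed.

(** Forward steps end with [to_Ninfty], which avoids [nat]; backward ones would put an even number
    in the image of [odd_left]. *)
Lemma Rrel_even m i n : ~ Rrel to_Ninfty odd_left m (inl i.*2) (inl n).
Proof.
case: m => m /=; first by case: (iter _ _ _).
by case: (iter _ _ _) => //= k [E]; have := odd_double i; rewrite E /= odd_double.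
Qed.

Lemma Myhill_LPO :
  Markov_principle -> nn_strong_Myhill (nat + Ninfty) -> LPO.
Proof.
move=> mp myhill.
have [h [[h' hK h'K] hR]] := myhill _ _ to_Ninfty_inj odd_left_inj.
pose phi u := if h' (inr u) is inl _ then true else false.
apply: (@LPO_of_unbounded_test phi mp) => [|n phi_lt].
  rewrite /phi; case E: (h' _) => [m|//].
  by case: (hR (inl m)) => -[j]; rewrite -E h'K E => /Rrel_inf.
have h_even i : exists k, h (inl i.*2) = inr (Ninfty_fin k).
  case E: (h (inl i.*2)) => [m|u].
    by case: (hR (inl i.*2)) => -[j]; rewrite E => /Rrel_even.
  have [Eu | k ->] := @Markov_Ninfty u mp; last by exists k.
  by case: (hR (inl i.*2)) => -[j]; rewrite E Eu => /Rrel_inf.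
(* [r k] recovers [i.*2] from [h (inl i.*2) = k < n]: pigeonhole. *)
pose r k := if h' (inr (Ninfty_fin k)) is inl m then m else 0.
(* If the test held only below [n], these [n.+1] distinct numbers would all be among the [n] values
   [r k]. *)
have /uniq_leq_size : uniq [seq i.*2 | i <- iota 0 n.+1].
  by rewrite (map_inj_uniq double_inj) iota_uniq.
move=> /(_ [seq r k | k <- iota 0 n]); rewrite !size_map !size_iota ltnn.
move=> H; apply/notF/H => _ /mapP[i _ ->]; have [k Ek] := h_even i.
have Ek' : h' (inr (Ninfty_fin k)) = inl i.*2 by rewrite -Ek hK.
apply/mapP; exists k; last by rewrite /r Ek'.
by rewrite mem_iota; apply: phi_lt; rewrite /phi Ek'.
Qed.

Theorem theorem48 :
  Markov_principle -> (LPO <-> nn_strong_Myhill (nat + Ninfty)).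
Proof. by move=> mp; split; [apply: LPO_Myhill | apply: Myhill_LPO]. Qed.
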